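(* Let there be given a primary pseudo $(v,k,\lambda)$-design with $k=\lambda+1$ or $k=\lambda+2$. Then its parameters satisfy at least one of the following four conditions: (i) $(k-1)(k-2)=(\lambda-1)(v-2)$; (ii) $k(k-1)=\lambda(v-2)$; (iii) $k(k-1)=\lambda(v-1)$; (iv) $k=2\lambda$.
   Context: A pseudo $(v,k,\lambda)$-design is a pair $(X,\mathcal{B})$ where $X$ is a $v$-set and $\mathcal{B}=\{B_1,\ldots,B_{v-1}\}$ is a collection of $v-1$ $k$-subsets (blocks) of $X$ such that any two distinct blocks $B_i,B_j$ intersect in exactly $\lambda$ elements, with $0\le\lambda<k\le v-1$. It is called primary if $v\lambda\ne k^2$. *)

(* Defs.v *)
From mathcomp Require Import all_boot all_order all_algebra.

Set Implicit Arguments.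
Unset Strict Implicit.
Unset Printing Implicit Defensive.

(* The v-set of points is a finType with v elements. The blocks form a set of
   subsets, so #|B| counts distinct blocks; this loses nothing with respect to
   an indexed family, since lambda < k forbids repeated blocks. *)
Record pseudo_design (X : finType) (v k lambda : nat) (B : {set {set X}})
    : Prop := PseudoDesign {
  card_points : #|X| = v;
  card_blocks : #|B| = v - 1;
  block_size : forall b, b \in B -> #|b| = k;
  block_inter : forall b1 b2, b1 \in B -> b2 \in B -> b1 != b2 ->
    #|b1 :&: b2| = lambda;
  param_bounds : [&& 0 <= lambda, lambda < k & k <= v - 1]
}.

Definition primary_pseudo_design (X : finType) (v k lambda : nat)
    (B : {set {set X}}) : Prop :=
  pseudo_design v k lambda B /\ v * lambda <> k ^ 2.

(* Main.v *)
(* Taking symmetric differences with a fixed block D turns the other v - 2 blocks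
   into sets of size 2(k - lambda) that pairwise meet in k - lambda points.  Such
   a family is either bounded in size or a sunflower.  For k = lambda + 1 a
   sunflower forces k <= 2 or v <= k + 2.  For k = lambda + 2 it cannot fit on v
   points, so v <= 9; the Cauchy-Schwarz inequality for the replication numbers,
   the same bound applied to the complements of the blocks when (v, k) = (9, 5),
   and primarity then leave only lambda = 2 and
   (lambda, v) = (1, 7), (1, 8), (3, 8). *)

Require Import Defs.
From mathcomp Require Import all_boot all_order all_algebra.
From mathcomp Require Import zify ring.

Set Implicit Arguments.
Unset Strict Implicit.
Unset Printing Implicit Defensive.

Import Order.TTheory GRing.Theory Num.Theory.
Local Open Scope ring_scope.

(** * Sunflowers and the petals cut out by another set *)

Lemma card_sum_mem (X : finType) (A : {set X}) :
  #|A| = (\sum_(x : X) (x \in A))%N.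
Proof. by rewrite -sum1_card big_mkcond; apply: eq_bigr => x _; case: ifP. Qed.

(** Outside [T] the members of [F] are pairwise disjoint, so exchanging the sums counts each point
    of [U] at most once. The free set [U] is later another member, the whole space, a block or the
    complement of a block. *)
Lemma sunflower_bound (X : finType) (F : {set {set X}}) (T U : {set X}) :
    {in F &, forall A C, A != C -> A :&: C \subset T} ->
  (\sum_(A in F) #|(U :&: A) :\: T| + #|U :&: T| <= #|U|)%N.
Proof.
move=> capT.
under eq_bigr => A _ do rewrite card_sum_mem.
rewrite exchange_big /= (card_sum_mem (U :&: T)) -big_split /= (card_sum_mem U).
apply: leq_sum => x _; rewrite inE.
case: (boolP (x \in T)) => xT; last first.
  rewrite andbF addn0; case: (boolP (x \in U)) => xU; last first.
    by rewrite big1 // => A _; rewrite !inE (negPf xU) andbF.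
  case: (pickP [pred A in F | x \in A]) => [A /andP[AF xA]|noA]; last first.
    rewrite big1 // => A AF; rewrite !inE.
    by have /negbT := noA A; rewrite inE /= AF /= => /negPf->; rewrite !andbF.
  rewrite (bigD1 A) //= big1 ?addn0 ?leq_b1 // => C /andP[CF CA].
  rewrite !inE xT xU /=; case: (boolP (x \in C)) => // xC.
  by move: xT; rewrite (subsetP (capT A C AF CF _)) // ?inE ?xA // eq_sym.
by rewrite andbT big1 // => A _; rewrite !inE xT.
Qed.

Lemma sunflower_card (X : finType) (F : {set {set X}}) (T U : {set X}) (c : nat) :
    {in F &, forall A C, A != C -> A :&: C \subset T} ->
    {in F, forall A : {set X}, T \subset A} ->
    {in F, forall A, #|U :&: A| = c} ->
  (#|F| * (c - #|U :&: T|) + #|U :&: T| <= #|U|)%N.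
Proof.
move=> capT subT capU; apply: leq_trans (sunflower_bound U capT).
rewrite leq_add2r -sum_nat_const; apply: leq_sum => A AF.
rewrite cardsD (capU A AF) leq_sub2l // subset_leq_card //.
by rewrite -setIA setIS // subsetIr.
Qed.

Definition star (X : finType) (F : {set {set X}}) (T : {set X}) : {set {set X}} :=
  [set S in F | T \subset S].

Lemma star_inter (X : finType) (F : {set {set X}}) (T : {set X}) :
    {in F &, forall A C, A != C -> #|A :&: C| = #|T|} ->
  {in star F T &, forall A C, A != C -> A :&: C \subset T}.
Proof.
move=> FT A C; rewrite !inE => /andP[AF TA] /andP[CF TC] AC.
suff /eqP <- : T == A :&: C by [].
by rewrite eqEcard subsetI TA TC /= FT.
Qed.

(** Every member of the star meets [S] in [#|T|] points, of which at most [#|S :&: T|] lie in [T];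
    the others lie in disjoint petals and must all fit into [S]. *)
Lemma star_petals (X : finType) (F : {set {set X}}) (T S : {set X}) :
    {in F &, forall A C, A != C -> #|A :&: C| = #|T|} ->
    S \in F -> ~~ (T \subset S) ->
  (#|star F T| * (#|T| - #|S :&: T|) + #|S :&: T| <= #|S|)%N.
Proof.
move=> FT SF TS.
apply: sunflower_card (star_inter FT) _ _ => [A|A]; rewrite inE => /andP[AF TA] //.
by apply: FT => //; apply: contraNneq TS => ->.
Qed.

(** * Families of 2-sets and 4-sets with constant intersection size *)

(** Without a common point, some pair avoids [x] and meets each pair through [x] in a different
    point, so at most two pairs contain [x]. All members meet a fixed pair [S], which lies in both
    stars at its points: 2 + 2 - 1 = 3. *)
Lemma pair_family_bound (X : finType) (F : {set {set X}}) :
    {in F, forall A : {set X}, #|A| = 2%N} ->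
    {in F &, forall A C, A != C -> #|A :&: C| = 1%N} ->
  (#|F| <= 3)%N \/ exists x, {in F, forall A : {set X}, x \in A}.
Proof.
move=> F2 F1.
case: (boolP [exists x, [forall A in F, x \in A]]).
  by case/existsP => x /forall_inP; right; exists x.
rewrite negb_exists => /forallP nostar; left.
have star2 x : (#|star F [set x]| <= 2)%N.
  have := nostar x; rewrite negb_forall => /existsP[A]; rewrite negb_imply => /andP[AF xA].
  have Fx : {in F &, forall A C, A != C -> #|A :&: C| = #|[set x]|}.
    by move=> C E CF EF CE; rewrite cards1 F1.
  have := star_petals Fx AF; rewrite sub1set cards1 (F2 A AF) => /(_ xA).
  have -> : A :&: [set x] = set0.
    by apply/eqP; rewrite setI_eq0 disjoint_sym disjoints1.
  by rewrite cards0 subn0 addn0 muln1.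
have [->|[S SF]] := set_0Vmem F; first by rewrite cards0.
have /cards2P[a [b [ab SE]]] : #|S| == 2%N by rewrite F2.
have : F \subset star F [set a] :|: star F [set b].
  apply/subsetP => A AF; rewrite !inE AF !sub1set /=.
  rewrite -[_ || _]negbK negb_or; apply/negP => /andP[aA bA]; have := F1 S A SF AF.
  have -> : S :&: A = set0.
    apply/setP => x; rewrite SE !inE.
    by case: eqP => [->|_]; rewrite ?(negPf aA) ?andbF //; case: eqP => [->|//]; rewrite (negPf bA).
  rewrite cards0; case: (eqVneq S A) => [SA _|_ /(_ isT)//].
  by move: aA; rewrite -SA SE !inE eqxx.
move/subset_leq_card; rewrite cardsU.
have : (0 < #|star F [set a] :&: star F [set b]|)%N.
  by apply/card_gt0P; exists S; rewrite !inE SF !sub1set SE !inE !eqxx orbT.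
by have := star2 a; have := star2 b; lia.
Qed.

(** A member not containing [T] meets it in t <= 1 points and would need 4(2 - t) + t > 4 points to
    reach four petals. So all of [F] is a sunflower with kernel [T] and petals of size 2. *)
Lemma star_large (X : finType) (F : {set {set X}}) (T : {set X}) :
    {in F, forall A : {set X}, #|A| = 4%N} ->
    {in F &, forall A C, A != C -> #|A :&: C| = 2%N} ->
    #|T| = 2%N -> (4 <= #|star F T|)%N ->
  (2 * #|F| + 2 <= #|X|)%N.
Proof.
move=> F4 F2 T2 big.
have FT : {in F &, forall A C, A != C -> #|A :&: C| = #|T|} by rewrite T2.
have allT : {in F, forall S : {set X}, T \subset S}.
  move=> S SF; apply/negP => /negP TS.
  have := star_petals FT SF TS; rewrite (F4 S SF) T2.
  have : (#|S :&: T| < 2)%N.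
    rewrite -T2 proper_card // properE subsetIr /=.
    by apply: contra TS => /subset_trans; apply; apply: subsetIl.
  nia.
have starE : star F T = F.
  by apply/setP => S; rewrite inE; case: (boolP (S \in F)) => //= /allT.
have := @sunflower_card _ F T [set: X] 4 _ allT.
rewrite setTI T2 cardsT mulnC; apply; first by have := star_inter FT; rewrite starE.
by move=> A AF; rewrite setTI F4.
Qed.

(* Deza's bound for distance 4: each of the three splittings of a fixed member
   S0 into two pairs is the trace of at most two other members. *)
Lemma quadruple_family_bound (X : finType) (F : {set {set X}}) :
    {in F, forall A : {set X}, #|A| = 4%N} ->
    {in F &, forall A C, A != C -> #|A :&: C| = 2%N} ->
  (#|F| <= 7)%N \/ (2 * #|F| + 2 <= #|X|)%N.
Proof.
move=> F4 F2; have [F0|[S0 S0F]] := set_0Vmem F; first by left; rewrite F0 cards0.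
case: (boolP [exists T : {set X}, (#|T| == 2%N) && (4 <= #|star F T|)%N]).
  by case/existsP => T /andP[/eqP T2 /(star_large F4 F2 T2)]; right.
rewrite negb_exists => /forallP small; left.
pose D := [set A : {set X} | A \subset S0 & #|A| == 2%N].
pose c (A : {set X}) := #|[set S in F :\ S0 | S :&: S0 == A]|.
have DC T : T \in D -> S0 :\: T \in D.
  rewrite !inE subsetDl => /andP[TS /eqP T2].
  by rewrite cardsD (setIidPr TS) T2 F4.
have DCK T : T \in D -> S0 :\: (S0 :\: T) = T.
  by rewrite inE => /andP[TS _]; rewrite setDDr setDv set0U; apply/setIidPr.
(* A member other than [S0] meets [S0] in two points, so it contains [T] exactly when its trace is
   [T]; the successor accounts for [S0] itself. *)
have cstar T : T \in D -> (c T).+1 = #|star F T|.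
  rewrite inE => /andP[TS /eqP T2].
  rewrite (cardsD1 S0 (star F T)) inE S0F TS add1n; congr _.+1.
  apply: eq_card => S; rewrite !inE; case: (boolP (S != S0)) => //= SS0.
  case: (boolP (S \in F)) => //= SF; rewrite eq_sym.
  by rewrite eqEcard subsetI TS andbT (F2 S S0 SF S0F SS0) T2 leqnn andbT.
have cle2 T : T \in D -> (c T <= 2)%N.
  move=> TD; have := small T; rewrite -(cstar _ TD).
  by move: TD; rewrite inE => /andP[_ ->] /=; lia.
(* Here the star of [T] has three members. A member with the complementary trace is disjoint from
   [T], so it would need two points in each of three petals. *)
have c2 T : T \in D -> (c T = 2)%N -> c (S0 :\: T) = 0%N.
  move=> TD cT; apply/eqP; rewrite cards_eq0; apply/set0Pn => -[S].
  rewrite !inE => /andP[/andP[SS0 SF] /eqP SE].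
  have := cstar T TD; rewrite cT => st.
  have := TD; rewrite inE => /andP[TS /eqP T2].
  have ST : S :&: T = set0.
    apply/eqP; rewrite -subset0; apply/subsetP => x; rewrite !inE => /andP[xS xT].
    by have := subsetP TS x xT; move/setP/(_ x): SE; rewrite !inE xS xT /= => ->.
  have FT : {in F &, forall A C, A != C -> #|A :&: C| = #|T|} by rewrite T2.
  have TS' : ~~ (T \subset S).
    by apply/negP => /setIidPr; rewrite ST => T0; rewrite -T0 cards0 in T2.
  by have := star_petals FT SF TS'; rewrite -st ST cards0 T2 (F4 S SF).
have csum T : T \in D -> (c T + c (S0 :\: T) <= 2)%N.
  move=> TD; have := cle2 _ TD; have := cle2 _ (DC _ TD); have := c2 _ TD.
  by have := c2 _ (DC _ TD); rewrite DCK //; lia.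
have cardF : #|F :\ S0| = (\sum_(T in D) c T)%N.
  rewrite -sum1_card (partition_big (fun S => S :&: S0) (mem D)) /=.
    by apply: eq_bigr => T _; rewrite /c -sum1_card; apply: eq_bigl => S; rewrite !inE.
  by move=> S; rewrite !inE => /andP[SS0 SF]; rewrite subsetIr F2.
have cardF' : #|F :\ S0| = (\sum_(T in D) c (S0 :\: T)%SET)%N.
  rewrite cardF (reindex_onto (fun T => S0 :\: T) (fun T => S0 :\: T)) /=; last exact: DCK.
  apply: eq_bigl => T; case: (boolP (T \in D)) => TD; first by rewrite DC // DCK // eqxx.
  by apply/negP => /andP[/DC + /eqP E]; rewrite E (negPf TD).
(* Each of the 6 pairs in [S0], taken with its complement, contributes at most 2. *)
have : (#|F :\ S0| + #|F :\ S0| <= 12)%N.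
  rewrite {1}cardF cardF' -big_split /=.
  apply: (@leq_trans (\sum_(T in D) 2)%N); first exact: leq_sum.
  by rewrite sum_nat_const cards_draws F4.
by rewrite (cardsD1 S0 F) S0F; lia.
Qed.

(** * The variance inequality for replication numbers *)

Lemma replication_cauchy_schwarz (X : finType) (k l : nat) (F : {set {set X}}) :
    {in F, forall A : {set X}, #|A| = k} ->
    {in F &, forall A C, A != C -> #|A :&: C| = l} ->
  ((k * #|F|) ^ 2 <= #|X| * (#|F| * (k + l * (#|F| - 1))))%N.
Proof.
move=> Fk Fl.
pose r x : nat := (\sum_(A in F) (x \in A))%N.
have r1 : (\sum_x r x = k * #|F|)%N.
  rewrite exchange_big /= mulnC -sum_nat_const; apply: eq_bigr => A AF.
  by rewrite -card_sum_mem Fk.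
have r2 : (\sum_x r x ^ 2 = #|F| * (k + l * (#|F| - 1)))%N.
  transitivity (\sum_(A in F) \sum_(C in F) #|A :&: C|)%N.
    under [RHS]eq_bigr => A _ do
      (under eq_bigr => C _ do rewrite card_sum_mem; rewrite exchange_big).
    rewrite /= [RHS]exchange_big; apply: eq_bigr => x _ /=.
    rewrite -mulnn /r big_distrlr /=; apply: eq_bigr => A _.
    by apply: eq_bigr => C _; rewrite inE; do 2 case: (_ \in _).
  rewrite -sum_nat_const; apply: eq_bigr => A AF.
  rewrite (bigD1 A) //= setIid Fk // (eq_bigr (fun=> l)); last first.
    by move=> C /andP[CF CA]; apply: Fl; rewrite // eq_sym.
  rewrite (eq_bigl (mem (F :\ A))); last by move=> C; rewrite !inE andbC.
  by rewrite sum_nat_const (cardsD1 A F) AF mulnC; congr (_ + _ * _)%N; lia.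
rewrite -r2 -r1; set s := (\sum_x r x)%N; set q := (\sum_x _)%N.
have sE : s%:Z = \sum_x (r x)%:Z by rewrite /s -natz natr_sum; apply: eq_bigr => x _; rewrite natz.
have qE : q%:Z = \sum_x (r x)%:Z ^+ 2.
  by rewrite /q -natz natr_sum; apply: eq_bigr => x _; rewrite natrX natz.
(* The deviations of [r] from its mean are scaled by [#|X|] to stay integral; the extra factor
   [#|X|] is cancelled at the end, with empty [X] treated apart. *)
have : 0 <= \sum_x (#|X|%:Z * (r x)%:Z - s%:Z) ^+ 2 by apply: sumr_ge0 => x _; apply: sqr_ge0.
have -> : \sum_x (#|X|%:Z * (r x)%:Z - s%:Z) ^+ 2
    = #|X|%:Z * (#|X|%:Z * q%:Z - s%:Z ^+ 2).
  transitivity (\sum_x (#|X|%:Z ^+ 2 * (r x)%:Z ^+ 2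
      - (2 * #|X|%:Z * s%:Z) * (r x)%:Z + s%:Z ^+ 2)).
    by apply: eq_bigr => x _; ring.
  rewrite big_split /= sumrB -!mulr_sumr -sE -qE sumr_const -[#|xpredT|]/#|X|.
  by rewrite -[_ *+ #|X|]mulr_natr natz; ring.
case: (posnP #|X|) => [X0 _|X0].
  by rewrite /s big_pred0 // => x; move: (card0_eq X0 x).
by rewrite pmulr_rge0 //; lia.
Qed.

(** * Symmetric differences with a fixed block *)

Definition symdiff (X : finType) (A C : {set X}) : {set X} :=
  (A :\: C) :|: (C :\: A).

Lemma symdiffK (X : finType) (D : {set X}) :
  involutive (fun A : {set X} => symdiff A D).
Proof. by move=> A; apply/setP => x; rewrite !inE; do 2 case: (_ \in _). Qed.

Lemma card_symdiff (X : finType) (A C : {set X}) :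
  (#|symdiff A C| + 2 * #|A :&: C| = #|A| + #|C|)%N.
Proof.
rewrite !card_sum_mem big_distrr -!big_split; apply: eq_bigr => x _ /=.
by rewrite !inE; do 2 case: (_ \in _).
Qed.

Lemma card_symdiffI (X : finType) (A C D : {set X}) :
  (#|symdiff A D :&: symdiff C D| + #|A :&: D| + #|C :&: D| = #|A :&: C| + #|D|)%N.
Proof.
rewrite !card_sum_mem -!big_split; apply: eq_bigr => x _ /=.
by rewrite !inE; do 3 case: (_ \in _).
Qed.

Lemma card_setI_symdiff (X : finType) (A D : {set X}) :
  (#|D :&: symdiff A D| + #|A :&: D| = #|D|)%N.
Proof.
rewrite !card_sum_mem -!big_split; apply: eq_bigr => x _ /=.
by rewrite !inE; do 2 case: (_ \in _).
Qed.

Lemma card_setCI_symdiff (X : finType) (A D : {set X}) :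
  (#|~: D :&: symdiff A D| + #|A :&: D| = #|A|)%N.
Proof.
rewrite !card_sum_mem -!big_split; apply: eq_bigr => x _ /=.
by rewrite !inE; do 2 case: (_ \in _).
Qed.

Lemma card_setCIC (X : finType) (A C : {set X}) :
  (#|~: A :&: ~: C| + #|A| + #|C| = #|X| + #|A :&: C|)%N.
Proof.
rewrite -cardsT !card_sum_mem -!big_split; apply: eq_bigr => x _ /=.
by rewrite !inE; do 2 case: (_ \in _).
Qed.

Definition translates (X : finType) (B : {set {set X}}) (D : {set X}) :
    {set {set X}} :=
  [set symdiff A D | A in B :\ D].

Lemma translatesP (X : finType) (B : {set {set X}}) (D : {set X}) (k l : nat) :
    {in B, forall A : {set X}, #|A| = k} ->
    {in B &, forall A C, A != C -> #|A :&: C| = l} -> D \in B ->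
  [/\ #|translates B D| = (#|B| - 1)%N,
      {in translates B D, forall S : {set X},
        [/\ #|S| = (2 * (k - l))%N, #|D :&: S| = (k - l)%N
          & #|~: D :&: S| = (k - l)%N]}
    & {in translates B D &, forall S S', S != S' -> #|S :&: S'| = (k - l)%N}].
Proof.
move=> Bk Bl DB; split.
- rewrite card_imset; last exact: can_inj (@symdiffK X D).
  by rewrite (cardsD1 D B) DB add1n subn1.
- move=> _ /imsetP[A + ->]; rewrite !inE => /andP[AD AB].
  have := card_symdiff A D; have := card_setI_symdiff A D.
  by have := card_setCI_symdiff A D; rewrite (Bk A AB) (Bk D DB) (Bl A D AB DB AD); split; lia.
move=> _ _ /imsetP[A + ->] /imsetP[C + ->]; rewrite !inE => /andP[AD AB] /andP[CD CB] AC.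
have {}AC : A != C by apply: contraNneq AC => ->.
by have := card_symdiffI A C D; rewrite (Bk D DB) (Bl A C) // (Bl A D) // (Bl C D) //; lia.
Qed.

(** * Bounds on the number of points, and the theorem *)

Lemma pseudo_design_points_order1 (X : finType) (v k l : nat) (B : {set {set X}}) :
  pseudo_design v k l B -> k = (l + 1)%N -> (v <= 5)%N \/ (k <= 2)%N \/ (v <= k + 2)%N.
Proof.
case=> cX cB Bk Bl /and3P[_ lk kv] kE.
have /card_gt0P[D DB] : (0 < #|B|)%N by rewrite cB; lia.
have [cT TP TI] := translatesP Bk Bl DB.
have kl : (k - l = 1)%N by lia.
rewrite kl in TP TI; rewrite cB in cT.
case: (pair_family_bound _ TI) => [S /TP[] //||[x xT]]; first by rewrite cT; lia.
right.
have TIx : {in translates B D &, forall S S', S != S' -> S :&: S' \subset [set x]}.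
  move=> S S' ST S'T SS'.
  suff /eqP <- : [set x] == S :&: S' by [].
  by rewrite eqEcard sub1set inE !xT // cards1 TI.
have xsub : {in translates B D, forall S : {set X}, [set x] \subset S}.
  by move=> S ST; rewrite sub1set xT.
have cCD : #|~: D| = (v - k)%N by rewrite cardsCs setCK cX (Bk D).
have cI (U : {set X}) : x \notin U -> #|U :&: [set x]| = 0%N.
  by move=> xU; apply/eqP; rewrite cards_eq0 setI_eq0 disjoint_sym disjoints1.
(* Each of the v - 2 translates has one point in [D] and one outside. On the side not containing [x]
   these points are distinct, so v - 2 <= v - k or v - 2 <= k. *)
case: (boolP (x \in D)) => xD; [left|right].
  have := sunflower_card (U := ~: D) TIx xsub (fun S ST => let: And3 _ _ h := TP S ST in h).
  by rewrite cI ?inE ?xD // cCD cT; lia.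
have := sunflower_card (U := D) TIx xsub (fun S ST => let: And3 _ h _ := TP S ST in h).
by rewrite cI // (Bk D) // cT; lia.
Qed.

Lemma pseudo_design_points_order2 (X : finType) (v k l : nat) (B : {set {set X}}) :
  pseudo_design v k l B -> k = (l + 2)%N ->
  (v <= 9)%N /\ (v = (k + 4)%N -> (v <= 8)%N).
Proof.
case=> cX cB Bk Bl /and3P[_ lk kv] kE.
have /card_gt0P[D DB] : (0 < #|B|)%N by rewrite cB; lia.
have [cT TP TI] := translatesP Bk Bl DB.
have kl : (k - l = 2)%N by lia.
rewrite kl in TP TI; rewrite cB in cT.
split.
  by case: (quadruple_family_bound _ TI) => [S /TP[] //||]; rewrite cT ?cX; lia.
(* When v = k + 4 the complements are themselves 4-sets meeting in pairs. There are v - 1 of them,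
   one more than the translates, which improves the bound by one. *)
move=> vE; pose F := [set ~: A | A in B].
have cF : #|F| = (v - 1)%N by rewrite card_imset ?cB //; apply: setC_inj.
have F4 : {in F, forall A : {set X}, #|A| = 4%N}.
  by move=> _ /imsetP[A AB ->]; rewrite cardsCs setCK cX (Bk A) //; lia.
have F2 : {in F &, forall A C, A != C -> #|A :&: C| = 2%N}.
  move=> _ _ /imsetP[A AB ->] /imsetP[C CB ->] AC.
  have {}AC : A != C by apply: contraNneq AC => ->.
  by have := card_setCIC A C; rewrite cX (Bk A) // (Bk C) // (Bl A C) //; lia.
by case: (quadruple_family_bound F4 F2); rewrite cF ?cX; lia.
Qed.

Theorem corollary7 (X : finType) (v k lambda : nat) (B : {set {set X}})
    (hD : primary_pseudo_design v k lambda B)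
    (hk : k = (lambda + 1)%N \/ k = (lambda + 2)%N) :
  (k%:Z - 1) * (k%:Z - 2) = (lambda%:Z - 1) * (v%:Z - 2) \/
  k%:Z * (k%:Z - 1) = lambda%:Z * (v%:Z - 2) \/
  k%:Z * (k%:Z - 1) = lambda%:Z * (v%:Z - 1) \/
  k%:Z = 2 * lambda%:Z.
Proof.
case: hD => hP hprim; have [cX cB Bk Bl /and3P[_ lk kv]] := hP.
case: hk => kE.
  have {}hP := pseudo_design_points_order1 hP kE.
  (* Condition (ii) holds for k = 1 and (i) for k = 2, both sides being zero; for larger k, v = k +
     1 gives (iii) and v = k + 2 gives (ii). *)
  case: (leqP k 2) => k2.
    have [l0|l1] : lambda = 0%N \/ lambda = 1%N by lia.
      by right; left; rewrite kE l0; lia.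
    by left; rewrite kE l1; lia.
  have : v = (k + 1)%N \/ v = (k + 2)%N by lia.
  by case=> vE; right; [right; left|left]; nia.
have [v9 v8] := pseudo_design_points_order2 hP kE.
have := replication_cauchy_schwarz Bk Bl; rewrite cX cB kE => var.
rewrite kE in hprim kv v8 *.
have l7 : (lambda < 8)%N by lia.
(* The ranges are finite since v <= 9 and lambda + 2 <= v - 1. The premises are primarity, k <= v -
   1, the bound from complements and the variance inequality, all with k = l + 2. *)
have search : (all (fun l => all (fun v =>
    [&& v * l != (l + 2) ^ 2, l + 2 <= v - 1, (v == l + 6) ==> (v <= 8) &
        ((l + 2) * (v - 1)) ^ 2 <= v * ((v - 1) * (l + 2 + l * (v - 1 - 1)))]
    ==> (l == 2) || ((l, v) \in [:: (1, 7); (1, 8); (3, 8)])) (iota 0 10)) (iota 0 8))%N.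
  by vm_compute.
have lI : lambda \in iota 0 8 by rewrite mem_iota.
have vI : v \in iota 0 10 by rewrite mem_iota.
have {search lI vI} := allP (allP search _ lI) _ vI.
rewrite var kv andbT (introN eqP hprim) /=.
have -> /= : (v == lambda + 6)%N ==> (v <= 8)%N.
  by apply/implyP => /eqP vE; apply: v8; lia.
(* lambda = 2 gives (iv); the pairs (1, 7), (1, 8) and (3, 8) give (iii), (ii) and (i). *)
rewrite !inE !xpair_eqE => /orP[/eqP->|]; first by do 3 right.
by case/or3P => /andP[/eqP-> /eqP->]; [do 2 right; left|right; left|left].
Qed.
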